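(* Let $G$ be a group and let $H \le G$ be a subgroup of finite index $[G:H] = m$, for some $m \in \mathbb{N}$. If $H$ embeds in Thompson's group $V$, then $G$ embeds in $V$. Moreover, if $H$ embeds as a demonstrative subgroup of $V$, then $G$ embeds as a demonstrative subgroup of $V$.
   Context: Let $X^* = \{0,1\}^*$ be the set of finite binary words and let $\mathrm{Ends}(\mathcal{T}_2) = \{0,1\}^{\mathbb{N}}$ be the set of infinite binary strings with the product topology (a Cantor set). It is the set of ends of the infinite rooted binary tree $\mathcal{T}_2$, and the topology is that of the metric $d(\zeta_1,\zeta_2)=e^{-l}$, where $l$ is the length of the longest common prefix of $\zeta_1$ and $\zeta_2$. For $u \in X^*$ let $u* = \{u\hat\omega : \hat\omega \in \mathrm{Ends}(\mathcal{T}_2)\}$. Thompson's group $V$ is the group of homeomorphisms $f$ of $\mathrm{Ends}(\mathcal{T}_2)$ for which there are finite partitions $\{u_1*,\dots,u_n*\}$ and $\{v_1*,\dots,v_n*\}$ of $\mathrm{Ends}(\mathcal{T}_2)$ such that $f(u_i\hat\omega) = v_i\hat\omega$ for all $i$ and all $\hat\omega \in \mathrm{Ends}(\mathcal{T}_2)$. A subgroup $K \le V$ is demonstrative if there is an open set $U \subseteq \mathrm{Ends}(\mathcal{T}_2)$ such that for all $h_1,h_2 \in K$, $h_1U \cap h_2U \neq \emptyset$ if and only if $h_1=h_2$. A group $K$ embeds in $V$ if there is an injective homomorphism $K \to V$. It embeds as a demonstrative subgroup of $V$ if there is such a homomorphism whose image is a demonstrative subgroup of $V$. *)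

(* Defs.v *)
From HB Require Import structures.
From mathcomp Require Import all_boot monoid.
From mathcomp Require Import boolp classical_sets functions cardinality.
From mathcomp Require Import topology cantor.

Set Implicit Arguments.
Unset Strict Implicit.
Unset Printing Implicit Defensive.

Local Open Scope classical_set_scope.
Local Open Scope group_scope.

(* The inverse is a field so that it can be computed with; it is determined by
   the underlying map (homeo_inj). *)
Record homeo (T : topologicalType) := Homeo {
  homeo_fun :> T -> T;
  homeo_inv : T -> T;
  homeo_continuous : continuous homeo_fun;
  homeo_inv_continuous : continuous homeo_inv;
  homeoK : cancel homeo_fun homeo_inv;
  homeoVK : cancel homeo_inv homeo_fun }.

Section HomeoGroup.
Variable T : topologicalType.
Implicit Types f g h : homeo T.

Lemma homeo_inj f g : f =1 g -> f = g.
Proof.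
case: f g => [f f' cf cf' fK f'K] [g g' cg cg' gK g'K] /= /funext fg.
subst g; have fg' : f' = g' by apply/funext => x; rewrite -{1}(g'K x) fK.
by subst g'; congr Homeo; exact: Prop_irrelevance.
Qed.

Definition homeo1 : homeo T :=
  @Homeo T id id (fun=> cvg_id) (fun=> cvg_id) (fun=> erefl) (fun=> erefl).

Definition homeoV f : homeo T :=
  Homeo (@homeo_inv_continuous T f) (@homeo_continuous T f)
        (@homeoVK T f) (@homeoK T f).

Lemma continuous_homeo_comp (f g : T -> T) :
  continuous f -> continuous g -> continuous (f \o g).
Proof. by move=> cf cg x; apply: continuous_comp; [exact: cg|exact: cf]. Qed.

Definition homeoM f g : homeo T :=
  Homeo (continuous_homeo_comp (@homeo_continuous T f) (@homeo_continuous T g))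
        (continuous_homeo_comp (@homeo_inv_continuous T g)
                               (@homeo_inv_continuous T f))
        (can_comp (@homeoK T f) (@homeoK T g))
        (can_comp (@homeoVK T g) (@homeoVK T f)).

Lemma homeoMA : associative homeoM.
Proof. by move=> f g h; exact: homeo_inj. Qed.

Lemma homeo1M : left_id homeo1 homeoM.
Proof. by move=> f; exact: homeo_inj. Qed.

Lemma homeoM1 : right_id homeo1 homeoM.
Proof. by move=> f; exact: homeo_inj. Qed.

Lemma homeoVM : left_inverse homeo1 homeoV homeoM.
Proof. by move=> f; apply: homeo_inj => x; exact: homeoK. Qed.

Lemma homeoMV : right_inverse homeo1 homeoV homeoM.
Proof. by move=> f; apply: homeo_inj => x; exact: homeoVK. Qed.

HB.instance Definition _ := gen_eqMixin (homeo T).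
HB.instance Definition _ := gen_choiceMixin (homeo T).
HB.instance Definition _ :=
  isGroup.Build (homeo T) homeoMA homeo1M homeoM1 homeoVM homeoMV.

Lemma homeoME f g x : (f * g) x = f (g x).
Proof. by []. Qed.

Lemma homeoVE f : homeo_fun f^-1 = homeo_inv f.
Proof. by []. Qed.

End HomeoGroup.

(* The product topology of cantor_space is that of the metric e^-l, with l the
   length of the longest common prefix. *)
Definition prepend (u : seq bool) (w : cantor_space) : cantor_space :=
  fun n => if n < size u then nth false u n else w (n - size u).

Definition cone (u : seq bool) : set cantor_space := range (prepend u).

(* Cones are nonempty, so disjointness over indices makes the words u i pairwise
   distinct: the family is a partition listed without repetition. *)
Definition cone_partition (I : Type) (u : I -> seq bool) : Prop :=
  partition [set: I] (fun i => cone (u i)) [set: cantor_space].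

Definition is_thompson (f : homeo cantor_space) : Prop :=
  exists (n : nat) (u v : 'I_n -> seq bool),
    [/\ cone_partition u, cone_partition v &
        forall i w, f (prepend (u i) w) = prepend (v i) w].

Definition thompson_pred : {pred homeo cantor_space} :=
  fun f => `[< is_thompson f >].

Lemma prepend_inj u : injective (prepend u).
Proof.
move=> a b ab; apply/funext => n; have := congr1 (fun w : cantor_space => w (n + size u)%N) ab.
by rewrite /prepend ltnNge leq_addl /= addnK.
Qed.

Lemma prepend_cat u v w : prepend (u ++ v) w = prepend u (prepend v w).
Proof.
apply/funext => n; rewrite /prepend size_cat nth_cat.
have [nu|un] := ltnP n (size u); first by rewrite ltn_addr.
by rewrite -{1}(subnKC un) ltn_add2l subnDA.
Qed.

Lemma prepend_nil w : prepend [::] w = w.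
Proof. by apply/funext => n; rewrite /prepend /= subn0. Qed.

Lemma prepend_eq_le u v a b : size v <= size u ->
  prepend v a = prepend u b ->
  v ++ drop (size v) u = u /\ a = prepend (drop (size v) u) b.
Proof.
move=> vu ab.
have uE : v ++ drop (size v) u = u.
  rewrite -[RHS](cat_take_drop (size v)); congr (_ ++ _).
  apply: (@eq_from_nth _ false); first by rewrite size_takel.
  move=> n nv; have := congr1 (fun w : cantor_space => w n) ab.
  by rewrite /prepend nv (leq_trans nv vu) nth_take.
by split=> //; apply: (@prepend_inj v); rewrite -prepend_cat uE.
Qed.

Lemma prepend_eq u v a b : prepend v a = prepend u b ->
  v ++ drop (size v) u = u ++ drop (size u) v /\
  exists2 c, a = prepend (drop (size v) u) c & b = prepend (drop (size u) v) c.
Proof.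
move=> ab; have [vu|/ltnW uv] := leqP (size v) (size u).
  have [uE aE] := prepend_eq_le vu ab; have du := drop_oversize vu.
  by rewrite du cats0 uE; split=> //; exists b; rewrite ?prepend_nil.
have [vE bE] := prepend_eq_le uv (esym ab); have dv := drop_oversize uv.
by rewrite dv cats0 vE; split=> //; exists a; rewrite ?prepend_nil.
Qed.

Lemma cone_partitionP (I : Type) (u : I -> seq bool) :
  (forall x, exists i w, x = prepend (u i) w) ->
  (forall i j a b, prepend (u i) a = prepend (u j) b -> i = j) ->
  cone_partition u.
Proof.
move=> uT uI; split.
- by apply/seteqP; split=> // x _; have [i [w ->]] := uT x; exists i => //; exists w.
- by move=> i j _ _ [x [[a _ ax] [b _ bx]]]; apply: (uI i j a b); rewrite ax bx.
- by move=> i _; exists (prepend (u i) point), point.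
Qed.

Lemma cone_partition_cover (I : Type) (u : I -> seq bool) : cone_partition u ->
  forall x, exists i w, x = prepend (u i) w.
Proof.
case=> uT _ _ x; have : [set: cantor_space] x by [].
by rewrite -uT => -[i _ [w _ <-]]; exists i, w.
Qed.

Lemma cone_partition_inj (I : Type) (u : I -> seq bool) : cone_partition u ->
  forall i j a b, prepend (u i) a = prepend (u j) b -> i = j.
Proof.
case=> _ uI _ i j a b ab; apply: uI => //.
by exists (prepend (u i) a); split; [exists a|exists b].
Qed.

Lemma is_thompson_fin (I : finType) (f : homeo cantor_space)
    (u v : I -> seq bool) :
  cone_partition u ->
  (forall i w, f (prepend (u i) w) = prepend (v i) w) -> is_thompson f.
Proof.
move=> pu fuv; exists #|I|, (u \o enum_val), (v \o enum_val); split.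
- apply: cone_partitionP => [x|i j a b /(cone_partition_inj pu)/enum_val_inj//].
  have [i [w ->]] := cone_partition_cover pu x.
  by exists (enum_rank i), w; rewrite /= enum_rankK.
- apply: cone_partitionP => [x|i j a b /=].
    have [i [w xE]] := cone_partition_cover pu (homeo_inv f x).
    exists (enum_rank i), w; rewrite /= enum_rankK -fuv -xE.
    by rewrite homeoVK.
  by rewrite -!fuv => /(can_inj (@homeoK _ f))/(cone_partition_inj pu)/enum_val_inj.
- by move=> i w /=.
Qed.

Lemma thompson1 : is_thompson 1.
Proof.
apply: (@is_thompson_fin unit _ (fun=> [::]) (fun=> [::])) => //.
by apply: cone_partitionP => [x|[] []//]; exists tt, x; rewrite prepend_nil.
Qed.

Lemma thompsonV f : is_thompson f -> is_thompson f^-1.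
Proof.
move=> [n [u [v [pu pv fuv]]]]; exists n, v, u; split=> // i w.
by rewrite homeoVE -fuv homeoK.
Qed.

Lemma thompsonM f g : is_thompson f -> is_thompson g -> is_thompson (f * g).
Proof.
move=> [m [u [v [pu _ fuv]]]] [n [u' [v' [pu' _ guv]]]].
pose ok (p : 'I_m * 'I_n) :=
  v' p.2 ++ drop (size (v' p.2)) (u p.1) ==
  u p.1 ++ drop (size (u p.1)) (v' p.2).
pose d (p : {p | ok p}) :=
  u' (val p).2 ++ drop (size (v' (val p).2)) (u (val p).1).
pose r (p : {p | ok p}) :=
  v (val p).1 ++ drop (size (u (val p).1)) (v' (val p).2).
have gd p w : g (prepend (d p) w) =
    prepend (u (val p).1 ++ drop (size (u (val p).1)) (v' (val p).2)) w.
  by rewrite /d prepend_cat guv -prepend_cat (eqP (valP p)).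
apply: (@is_thompson_fin _ _ d r); last first.
  by move=> p w; rewrite homeoME gd /r !prepend_cat fuv.
apply: cone_partitionP => [x|p q a b pq].
  have [j [a xE]] := cone_partition_cover pu' x.
  have [i [b gxE]] := cone_partition_cover pu (g x).
  have vu : prepend (v' j) a = prepend (u i) b by rewrite -gxE xE guv.
  have [/eqP okij [c aE _]] := prepend_eq vu.
  by exists (exist ok (i, j) okij), c; rewrite xE aE -prepend_cat.
apply: val_inj; apply/eqP; rewrite -pair_eqE; apply/andP; split; apply/eqP.
  have := congr1 g pq; rewrite !gd !prepend_cat; exact: cone_partition_inj.
by move: pq; rewrite /d !prepend_cat; exact: cone_partition_inj.
Qed.

Lemma thompson_group_closed : group_closed thompson_pred.
Proof.
split=> [|f g]; rewrite !unfold_in; first exact/asboolP/thompson1.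
by move=> /asboolP Vf /asboolP Vg; apply/asboolP/thompsonM => //; exact: thompsonV.
Qed.

Definition thompsonV_group := {f : homeo cantor_space | thompson_pred f}.

HB.instance Definition _ := Choice.on thompsonV_group.
HB.instance Definition _ := SubChoice.on thompsonV_group.
HB.instance Definition _ := SubChoice_isSubGroup.Build
  _ thompson_pred thompsonV_group thompson_group_closed.

(* U cannot be empty as soon as K is not: take h1 = h2. *)
Definition demonstrative (K : set thompsonV_group) : Prop :=
  exists2 U : set cantor_space, open U &
    forall h1 h2, K h1 -> K h2 ->
      ((val h1 @` U) `&` (val h2 @` U) !=set0 <-> h1 = h2).

Definition embeds_in_V (K : groupType) : Prop :=
  exists phi : {multiplicative K -> thompsonV_group}, injective phi.

Definition embeds_demonstratively_in_V (K : groupType) : Prop :=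
  exists phi : {multiplicative K -> thompsonV_group},
    injective phi /\ demonstrative (range phi).

Definition left_coset (G : groupType) (S : {pred G}) (g : G) : set G :=
  [set g * h | h in [set h | h \in S]].

Definition has_index (G : groupType) (S : {pred G}) (m : nat) : Prop :=
  (range (left_coset S) #= `I_m)%card.

(* Main.v *)
(* A transversal t_0, ..., t_(m-1) of the left cosets of H identifies G with
   m copies of H, G acting by g t_i = t_j h.  Cutting the Cantor set into m
   cones w_i* and letting g send w_i x to w_j phi(h)(x) induces an action phi
   of H by elements of V to an action of G by elements of V.  It is faithful if
   phi is, and if U witnesses that phi(H) is demonstrative then w_0 U does so
   for the image of G. *)
Require Import Defs.
From HB Require Import structures.
From mathcomp Require Import all_boot monoid.
From mathcomp Require Import boolp classical_sets functions cardinality.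
From mathcomp Require Import topology cantor.

Set Implicit Arguments.
Unset Strict Implicit.
Unset Printing Implicit Defensive.

Local Open Scope classical_set_scope.
Local Open Scope group_scope.

(** * Topology of prefixing in the Cantor space *)

Lemma near_coord (x : cantor_space) n : \forall y \near x, y n = x n.
Proof.
have : {for x, continuous (fun y : cantor_space => y n)}.
  exact: (@proj_continuous nat (fun=> bool) n).
by move=> /(_ [set x n]); apply; exact: discrete_set1.
Qed.

(** The product topology is initial for the coordinates, and local constancy of each coordinate
    gives its continuity. *)
Lemma continuous_coord (T : topologicalType) (f : T -> cantor_space) x :
  (forall n, \forall y \near x, f y n = f x n) -> {for x, continuous f}.
Proof.
move=> fx; apply/cvg_sup => n U [V [[W oW <-] Wfx] WU].
by near_simpl; apply: filterS (fx n) => y fyx; apply: WU; rewrite /= fyx.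
Qed.

Definition drop_prefix k (x : cantor_space) : cantor_space :=
  fun n => x (n + k).

Lemma prependK u : cancel (prepend u) (drop_prefix (size u)).
Proof.
move=> x; apply/funext => n.
by rewrite /drop_prefix /prepend ltnNge leq_addl /= addnK.
Qed.

Lemma drop_prefix_continuous k : continuous (drop_prefix k).
Proof. by move=> x; apply: continuous_coord => n; exact: near_coord. Qed.

Lemma prepend_continuous u : continuous (prepend u).
Proof.
move=> x; apply: continuous_coord => n; rewrite /prepend.
by case: ifP => _; [near=> y|exact: near_coord].
Unshelve. all: by end_near. Qed.

(** Cones are open: lying in one constrains finitely many coordinates, each of them locally
    constant. *)
Lemma near_cone u a :
  \forall y \near prepend u a, y = prepend u (drop_prefix (size u) y).
Proof.
have yu (n : 'I_(size u)) : nbhs (prepend u a) [set y | y n = nth false u n].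
  by apply: filterS (near_coord _ n) => y /= ->; rewrite /prepend ltn_ord.
apply: filterS (filter_forall (nbhs_filter _) yu) => y {}yu.
apply/funext => n; rewrite /prepend /drop_prefix.
by case: ltnP => [nu|/subnK->//]; rewrite (yu (Ordinal nu) : y n = _).
Qed.

(** On the open cone of [u], prefixing is inverted by the continuous map [drop_prefix (size u)]. *)
Lemma prepend_open u (U : set cantor_space) :
  open U -> open (prepend u @` U).
Proof.
rewrite !openE => oU _ [a Ua <-].
have nU : \forall y \near prepend u a, U (drop_prefix (size u) y).
  by apply: drop_prefix_continuous; rewrite prependK; exact: oU.
rewrite /interior /=; near=> y; exists (drop_prefix (size u) y).
  by near: y.
by apply/esym; near: y; exact: near_cone.
Unshelve. all: by end_near. Qed.

(** Cones are open, so continuity can be checked on each; on the cone of [w i], [f] agrees with [f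
    \o prepend (w i) \o drop_prefix (size (w i))]. *)
Lemma cone_partition_continuous (I : Type) (w : I -> seq bool)
    (f : cantor_space -> cantor_space) :
  cone_partition w -> (forall i, continuous (f \o prepend (w i))) ->
  continuous f.
Proof.
move=> pw cf x; have [i [a xE]] := cone_partition_cover pw x.
have ci : {for x, continuous
    ((f \o prepend (w i)) \o drop_prefix (size (w i)))}.
  by apply: continuous_comp; [exact: drop_prefix_continuous|exact: cf].
move=> A fA; have {}/ci : nbhs
    (((f \o prepend (w i)) \o drop_prefix (size (w i))) x) A.
  by rewrite /= xE prependK -xE.
near_simpl => nA; have := near_cone (w i) a; rewrite -xE => nx.
by apply: filterS2 nx nA => y {2}->.
Qed.

(** The comb 0, 10, 110, ..., closed off by a word of 1s only: each induction step puts a 1 before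
    the old words and adds the word 0. *)
Lemma exists_cone_partition n :
  exists w : 'I_n.+1 -> seq bool, cone_partition w.
Proof.
elim: n => [|n [w pw]].
  exists (fun=> [::]); apply: cone_partitionP => [x|i j _ _ _].
    by exists ord0, x; rewrite prepend_nil.
  by rewrite !ord1.
exists (fun i => if unlift ord0 i is Some j then true :: w j else [:: false]).
have consE b u x : prepend (b :: u) x = prepend [:: b] (prepend u x).
  by rewrite -prepend_cat.
apply: cone_partitionP => [x|i j a b].
  have xE : x = prepend [:: x 0%N] (drop_prefix 1 x).
    by apply/funext => -[|k] //; rewrite /prepend /drop_prefix /= subn1 addn1.
  case x0: (x 0%N) xE => xE; last first.
    by exists ord0, (drop_prefix 1 x); rewrite unlift_none.
  have [i [a dE]] := cone_partition_cover pw (drop_prefix 1 x).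
  by exists (lift ord0 i), a; rewrite liftK consE -dE.
have [i'|] := unliftP ord0 i => ->; have [j'|] := unliftP ord0 j => -> //.
- rewrite (consE _ (w i')) (consE _ (w j')).
  by move=> /prepend_inj/(cone_partition_inj pw) ->.
- by move=> /(congr1 (@^~ 0%N)).
- by move=> /(congr1 (@^~ 0%N)).
Qed.

(** * Transversals of the left cosets *)

Lemma multiplicative1 (G H : groupType) (f : {multiplicative G -> H}) : f 1 = 1.
Proof. by apply: (mulgI (f 1)); rewrite -gmulfM !mulg1. Qed.

Definition transversal (I : Type) (G : groupType) (S : {pred G})
    (H : subGroupType S) (t : I -> G) : Prop :=
  (forall g, exists i (k : H), g = t i * val k) /\
  (forall i j (k l : H), t i * val k = t j * val l -> i = j).

(** The index hypothesis numbers the cosets by a bijection [f]; [t i] is chosen in the coset with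
    number [i]. *)
Lemma has_index_transversal (G : groupType) (S : {pred G})
    (H : subGroupType S) m :
  has_index S m -> exists t : 'I_m -> G, transversal H t.
Proof.
move=> /card_set_bijP[f [fm finj fsurj]].
have valS (k : H) : val k \in S by exact: valP.
have Sval h : h \in S -> exists k : H, h = val k.
  by move=> hS; exists (@Sub _ _ H h hS); rewrite SubK.
have coset1 g : left_coset S g g.
  by exists (val (1 : H)); [exact: valS|rewrite gmulf1 mulg1].
have cosetM g (k : H) : left_coset S (g * val k) = left_coset S g.
  apply/seteqP; split=> x [_ /Sval[l ->] <-].
    by exists (val (k * l)); [exact: valS|rewrite gmulfM mulgA].
  by exists (val (k^-1 * l)); [exact: valS|rewrite gmulfM mulgA gmulfV mulgK].
have /choice[t tE] (i : 'I_m) : exists g, f (left_coset S g) = i.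
  by have [_ [g _ <-] fg] := fsurj _ (ltn_ord i); exists g.
exists t; split=> [g|i j k l tkl].
  have gm : f (left_coset S g) < m by apply: fm; exists g.
  (* The representative with the number of the coset of [g] lies in that coset, by injectivity of
     the numbering. *)
  have /finj : f (left_coset S (t (Ordinal gm))) = f (left_coset S g).
    exact: tE.
  move=> tg; have := coset1 g; rewrite -tg; last 2 first.
  - by rewrite inE; exists (t (Ordinal gm)).
  - by rewrite inE; exists g.
  by move=> [_ /Sval[k ->] <-]; exists (Ordinal gm), k.
by apply: val_inj; rewrite /= -!tE -(cosetM _ k) tkl cosetM.
Qed.

(** * The action of [G] induced from an action of [H] *)

Section InducedAction.
Variables (I : finType) (w : I -> seq bool).
Hypothesis pw : cone_partition w.
Variables (G : groupType) (S : {pred G}) (H : subGroupType S) (t : I -> G).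
Hypothesis tr : transversal H t.

Lemma transversal_inj i j (k l : H) :
  t i * val k = t j * val l -> i = j /\ k = l.
Proof.
move=> tkl; have ij := tr.2 _ _ _ _ tkl; split=> //.
by apply/val_inj/(mulgI (t i)); rewrite tkl ij.
Qed.

Variable phi : {multiplicative H -> thompsonV_group}.

(** Quantifying over all factorizations keeps choices out of later computations. The factorization
    exists and is unique and the cones cover the space, so [g] determines [f]. *)
Definition induces (g : G) (f : cantor_space -> cantor_space) : Prop :=
  forall i j k x, g * t i = t j * val k ->
    f (prepend (w i) x) = prepend (w j) (val (phi k) x).

Lemma exists_induces g : exists f, induces g f.
Proof.
have /choice[jk jkE] (i : I) :
    exists jk : I * H, g * t i = t jk.1 * val jk.2.
  by have [j [k gE]] := tr.1 (g * t i); exists (j, k).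
(* Disjointness of the cones and injectivity of prefixing make the value at [x] well defined. *)
have /choice[f fE] (x : cantor_space) : exists y, forall i a,
    x = prepend (w i) a ->
    y = prepend (w (jk i).1) (val (phi (jk i).2) a).
  have [i [a ->]] := cone_partition_cover pw x.
  exists (prepend (w (jk i).1) (val (phi (jk i).2) a)) => j b ab.
  by have ij := cone_partition_inj pw ab; subst j; rewrite (prepend_inj ab).
exists f => i j k x gE; have := jkE i; rewrite gE => /transversal_inj[-> ->].
exact: fE.
Qed.

Lemma induces1 f : induces 1 f -> f =1 id.
Proof.
move=> f1 x; have [i [a ->]] := cone_partition_cover pw x.
by rewrite (f1 i i 1) ?multiplicative1 ?gmulf1 ?mul1g ?mulg1.
Qed.

(** Cocycle rule: h t_i = t_j k and g t_j = t_l k' give g h t_i = t_l (k' k), and [phi] is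
    multiplicative. *)
Lemma inducesM g h f1 f2 f :
  induces g f1 -> induces h f2 -> induces (g * h) f -> f =1 f1 \o f2.
Proof.
move=> f1g f2h fgh x; have [i [a ->]] := cone_partition_cover pw x.
have [j [k hE]] := tr.1 (h * t i); have [l [k' gE]] := tr.1 (g * t j).
rewrite /= (f2h _ _ _ _ hE) (f1g _ _ _ _ gE) (fgh i l (k' * k)) ?gmulfM //.
by rewrite -mulgA hE !mulgA gE.
Qed.

Lemma induces_continuous g f : induces g f -> continuous f.
Proof.
move=> fg; apply: (cone_partition_continuous pw) => i.
have [j [k gE]] := tr.1 (g * t i).
have -> : f \o prepend (w i) = prepend (w j) \o val (phi k).
  by apply/funext => x /=; exact: fg.
apply: continuous_homeo_comp; last exact: homeo_continuous.
exact: prepend_continuous.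
Qed.

(** Each cone w_i* is subdivided by the domain partition of the element [phi k] acting from it. *)
Lemma induces_thompson g (f : homeo cantor_space) :
  induces g f -> is_thompson f.
Proof.
move=> fg.
(* The number of pieces varies with [i], hence the dependent pair. *)
have /choice[p pE] (i : I) :
    exists p : I * H * {n & ('I_n -> seq bool) * ('I_n -> seq bool)}%type,
    [/\ g * t i = t p.1.1 * val p.1.2, cone_partition (projT2 p.2).1 &
     forall a x, val (phi p.1.2) (prepend ((projT2 p.2).1 a) x) =
                 prepend ((projT2 p.2).2 a) x].
  have [j [k gE]] := tr.1 (g * t i).
  have /asboolP[n [u [v [pu _ uv]]]] := valP (phi k).
  by exists (j, k, existT _ n (u, v)).
pose J := {i : I & 'I_(projT1 (p i).2)}.
pose u (q : J) := w (tag q) ++ (projT2 (p (tag q)).2).1 (tagged q).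
pose v (q : J) := w (p (tag q)).1.1 ++ (projT2 (p (tag q)).2).2 (tagged q).
apply: (@is_thompson_fin J f u v).
  apply: cone_partitionP => [x|[i a] [j b] x y]; last first.
    rewrite /u !prepend_cat /= => e.
    have ij := cone_partition_inj pw e; subst j.
    have [_ pu _] := pE i.
    by have -> := cone_partition_inj pu (prepend_inj e).
  have [i [a ->]] := cone_partition_cover pw x.
  have [_ pu _] := pE i; have [b [y ->]] := cone_partition_cover pu a.
  by exists (Tagged (fun i => 'I_(projT1 (p i).2)) b), y; rewrite /u prepend_cat.
move=> [i a] x; have [gE _ uv] := pE i.
by rewrite /u /v !prepend_cat (fg _ _ _ _ gE) /= uv.
Qed.

Lemma exists_induced :
  exists Phi : {multiplicative G -> thompsonV_group},
    forall g, induces g (val (Phi g)).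
Proof.
have [f fE] := choice exists_induces.
(* The inverse of the map for g is the map for g^-1, by the product rule applied to g^-1 g = 1. *)
have fK g : cancel (f g) (f g^-1).
  move=> x; have := fE (g^-1 * g).
  by move=> /(inducesM (fE g^-1) (fE g))/(_ x)/= <-; rewrite mulVg induces1.
have fVK g : cancel (f g^-1) (f g) by rewrite -{2}(invgK g).
pose h g := Homeo (@induces_continuous _ _ (fE g))
  (@induces_continuous _ _ (fE g^-1)) (fK g) (fVK g).
have hV g : thompson_pred (h g).
  by apply/asboolP; apply: (@induces_thompson g); exact: fE.
pose Phi g : thompsonV_group := exist _ (h g) (hV g).
have PhiM : {morph Phi : x y / x * y}.
  move=> x y; apply/val_inj/homeo_inj => z.
  exact: (inducesM (fE x) (fE y) (fE (x * y))).
pose PhiB := isMultiplicative.Build G thompsonV_group Phi PhiM.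
pose Phi' : {multiplicative G -> thompsonV_group} := HB.pack Phi PhiB.
by exists Phi' => g; exact: fE.
Qed.

(** * Faithfulness and demonstrativity of the induced action *)

Variable Phi : {multiplicative G -> thompsonV_group}.
Hypothesis PhiE : forall g, induces g (val (Phi g)).
Hypothesis phi_inj : injective phi.
Variable i0 : I.

(** The two images lie in the cones w_j1* and w_j2*, where g_a t_i0 = t_ja k_a. Meeting forces j1 =
    j2; then phi(k1) U meets phi(k2) U, so k1 = k2. *)
Lemma induced_meet (U : set cantor_space) g1 g2 :
  (forall h1 h2, range phi h1 -> range phi h2 ->
    (val h1 @` U) `&` (val h2 @` U) !=set0 -> h1 = h2) ->
  (val (Phi g1) @` (prepend (w i0) @` U)) `&`
    (val (Phi g2) @` (prepend (w i0) @` U)) !=set0 -> g1 = g2.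
Proof.
move=> dU [x [[_ [a Ua <-] ax] [_ [b Ub <-] bx]]].
have [j1 [k1 g1E]] := tr.1 (g1 * t i0); have [j2 [k2 g2E]] := tr.1 (g2 * t i0).
have := etrans ax (esym bx); rewrite (PhiE _ g1E) (PhiE _ g2E) => ab.
have j12 := cone_partition_inj pw ab; subst j2.
apply/(mulIg (t i0)); rewrite g1E g2E; congr (_ * val _).
apply/phi_inj/dU; [by exists k1|by exists k2|].
exists (val (phi k1) a); split; first by exists a.
by exists b => //; rewrite (prepend_inj ab).
Qed.

Lemma induced_inj : injective Phi.
Proof.
move=> g1 g2 PhiE12.
have [j1 [k1 g1E]] := tr.1 (g1 * t i0); have [j2 [k2 g2E]] := tr.1 (g2 * t i0).
have e x : prepend (w j1) (val (phi k1) x) = prepend (w j2) (val (phi k2) x).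
  by rewrite -(PhiE x g1E) -(PhiE x g2E) PhiE12.
(* One point is enough to identify the target cones. *)
have j12 := cone_partition_inj pw (e point); subst j2.
apply/(mulIg (t i0)); rewrite g1E g2E; congr (_ * val _).
by apply/phi_inj/val_inj/homeo_inj => x; exact: prepend_inj (e x).
Qed.

Lemma induced_demonstrative :
  demonstrative (range phi) -> demonstrative (range Phi).
Proof.
move=> [U oU dU]; exists (prepend (w i0) @` U); first exact: prepend_open.
move=> _ _ [g1 _ <-] [g2 _ <-]; split=> [|<-].
  by move=> /induced_meet-> // h1 h2 h1K h2K /dU->.
(* [U] is nonempty: its translate by the identity meets itself. *)
have [x [[y Uy _] _]] := (dU (phi 1) (phi 1) (imageT _ _) (imageT _ _)).2 erefl.
rewrite setIid; exists (val (Phi g1) (prepend (w i0) y)).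
by exists (prepend (w i0) y) => //; exists y.
Qed.

End InducedAction.

Theorem theorem3p3 (G : groupType) (S : {pred G}) (H : subGroupType S) (m : nat) :
  has_index S m ->
  (embeds_in_V H -> embeds_in_V G) /\
  (embeds_demonstratively_in_V H -> embeds_demonstratively_in_V G).
Proof.
move=> /(has_index_transversal H)[t tr].
(* Index 0 is impossible, since factoring 1 through the transversal yields an element of ['I_0]. *)
case: m t tr => [|m] t tr; first by have [[]] := tr.1 1.
have [w pw] := exists_cone_partition m.
split=> [[phi phi_inj]|[phi [phi_inj dphi]]];
    have [Phi PhiE] := exists_induced pw tr phi.
  by exists Phi; exact: (induced_inj pw tr PhiE phi_inj ord0).
exists Phi; split; first exact: (induced_inj pw tr PhiE phi_inj ord0).
exact: (induced_demonstrative pw tr PhiE phi_inj ord0).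
Qed.
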